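(* Let $p=4$, let $X=(X_1,\ldots,X_4)\in\mathbb{R}^{n\times4}$ be a fair design with $X_1^TX_2=-\hat\rho$, $0<\hat\rho<1$, $\hat\varphi^2:=1-\hat\rho$, and let $\beta^0\in\mathbb{R}^4$ have active set $S_0=\{1,2\}$, so $S_0^c=\{3,4\}$, with $\beta_1^0\ge\beta_2^0>0$. Let $$(X_3,X_4)^T(X_3,X_4)=\begin{pmatrix}1&-\hat\theta\\-\hat\theta&1\end{pmatrix}$$ and write $\hat\psi^2:=1-\hat\theta$. Assume that $$X_1=C(X_3+X_4)/2+V,\qquad X_2=C(X_3+X_4)/2-V,$$ where $V$ is orthogonal to $X_3$ and $X_4$, $C>1$ and $C^2\hat\psi^2/2<1$. Then $$\hat\phi^2(S_0)=(C-1)^2\hat\psi^2,\qquad\hat\Gamma^2(S_0)=\frac{2}{(C-1)^2\hat\psi^2}.$$ Moreover, $\hat\varphi^2=C^2\hat\psi^2$, and for $\lambda>0$ with $\beta_2^0\ge\lambda/\hat\varphi^2$ the noiseless Lasso $\beta^*$ satisfies $$\|X(\beta^*-\beta^0)\|_2^2=\frac{2\lambda^2}{\hat\varphi^2}=\lambda^2\hat\Gamma^2(S_0)\frac{(C-1)^2}{C^2}$$ and $\|\beta_{-S_0}^*\|_1=0$.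
   Context: Fair design: all columns satisfy $\|X_j\|_2=1$ and there are no $j\ne k$ and constant $b$ with $X_j=bX_k$. The noiseless Lasso is $\beta^*:=\arg\min_{\beta\in\mathbb{R}^p}\{\|X(\beta-\beta^0)\|_2^2+2\lambda\|\beta\|_1\}$. For $S\subset\{1,\ldots,p\}$, $\beta_S$ is the vector with entries $\beta_j$ for $j\in S$ and $0$ otherwise, and $\beta_{-S}:=\beta_{S^c}$. The compatibility constant is $\hat\phi^2(S):=\min\{|S|\,\|X\beta\|_2^2:\ \|\beta_S\|_1=1,\ \|\beta_{-S}\|_1\le1\}$, and the effective sparsity is $\hat\Gamma^2(S):=|S|/\hat\phi^2(S)$. *)

(* Defs.v *)
From HB Require Import structures.
From mathcomp Require Import all_boot all_order all_algebra.
From mathcomp Require Import all_classical all_reals.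

Set Implicit Arguments.
Unset Strict Implicit.
Unset Printing Implicit Defensive.

Import Order.TTheory GRing.Theory Num.Theory.
Local Open Scope ring_scope.

(* The norm `|v| that MathComp-Analysis puts on matrices is the sup norm, hence
   the explicit l1 and l2 norms. *)
Definition l1norm (R : realType) (m : nat) (v : 'cV[R]_m) : R :=
  \sum_(i < m) `|v i 0|.

Definition l2norm (R : realType) (m : nat) (v : 'cV[R]_m) : R :=
  Num.sqrt (\sum_(i < m) v i 0 ^+ 2).

Definition fair_design (R : realType) (n p : nat) (X : 'M[R]_(n, p)) : Prop :=
  (forall j : 'I_p, l2norm (col j X) = 1) /\
  ~ (exists (j k : 'I_p) (b : R), j <> k /\ col j X = b *: col k X).

Definition active_set (R : realType) (p : nat) (b : 'cV[R]_p) : {set 'I_p} :=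
  [set j | b j 0 != 0].

Definition restr (R : realType) (p : nat) (S : {set 'I_p}) (b : 'cV[R]_p) :
    'cV[R]_p :=
  \col_j (if j \in S then b j 0 else 0).

Definition lasso_objective (R : realType) (n p : nat) (X : 'M[R]_(n, p))
    (b0 : 'cV[R]_p) (lambda : R) (b : 'cV[R]_p) : R :=
  l2norm (X *m (b - b0)) ^+ 2 + 2 * lambda * l1norm b.

(* The argmin as a set: in general the minimizer need not be unique. *)
Definition noiseless_lasso (R : realType) (n p : nat) (X : 'M[R]_(n, p))
    (b0 : 'cV[R]_p) (lambda : R) : set 'cV[R]_p :=
  [set b | forall b' : 'cV[R]_p,
     lasso_objective X b0 lambda b <= lasso_objective X b0 lambda b']%classic.

(* The least element of A; the default value 0 is returned if A has none. *)
Definition minimum (R : realType) (A : set R) : R :=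
  xget 0 (A `&` lbound A)%classic.

Definition compatibility2 (R : realType) (n p : nat) (X : 'M[R]_(n, p))
    (S : {set 'I_p}) : R :=
  minimum [set #|S|%:R * l2norm (X *m b) ^+ 2 | b in
    [set b : 'cV[R]_p | l1norm (restr S b) = 1 /\
                        l1norm (restr (~: S)%SET b) <= 1]]%classic.

Definition effective_sparsity2 (R : realType) (n p : nat) (X : 'M[R]_(n, p))
    (S : {set 'I_p}) : R :=
  #|S|%:R / compatibility2 X S.

(* The indices 1, ..., 4, shifted to the 0-based 'I_4. *)
Definition i1 : 'I_4 := @Ordinal 4 0 isT.
Definition i2 : 'I_4 := @Ordinal 4 1 isT.
Definition i3 : 'I_4 := @Ordinal 4 2 isT.
Definition i4 : 'I_4 := @Ordinal 4 3 isT.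

(* Main.v *)
(* Since X beta = (C s + c + d) (X3 + X4) / 2 + (c - d) (X3 - X4) / 2 + t V with
   s = a + b, t = a - b for beta = (a, b, c, d), and these three directions are
   orthogonal, |X beta|^2 is an explicit sum of three squares.  On the
   compatibility constraint max(|s|, |t|) = 1: if |s| = 1 the first square gives
   the bound, and if |t| = 1 the third one does because C^2 psi^2 < 1.  For the
   Lasso, the certificate at beta0 - (lambda / varphi^2) (1, 1, 0, 0) is 1 on S0
   and 1 / C < 1 off S0, so this point is the unique minimizer. *)
Require Import Defs.
From HB Require Import structures.
From mathcomp Require Import all_boot all_order all_algebra.
From mathcomp Require Import all_classical all_reals.
From mathcomp Require Import ring lra.

Set Implicit Arguments.
Unset Strict Implicit.
Unset Printing Implicit Defensive.

Import Order.TTheory GRing.Theory Num.Theory.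
Local Open Scope ring_scope.

Section L2.
Variables (R : realType) (n : nat).
Implicit Types u v w : 'cV[R]_n.

Lemma l2norm_sqr u : l2norm u ^+ 2 = (u^T *m u) 0 0.
Proof.
rewrite /l2norm sqr_sqrtr ?sumr_ge0 // => [|i _]; last exact: sqr_ge0.
by rewrite mxE; apply: eq_bigr => i _; rewrite mxE expr2.
Qed.

(** The mixed products with [w] keep [w^T] on the left, the form in which the orthogonality of [V]
    to [X3] and [X4] is given. *)
Lemma dotmx_lin3 (a b c : R) u v w :
  l2norm (a *: u + b *: v + c *: w) ^+ 2 =
  a ^+ 2 * (u^T *m u) 0 0 + b ^+ 2 * (v^T *m v) 0 0 + c ^+ 2 * (w^T *m w) 0 0 +
  2 * a * b * (u^T *m v) 0 0 + 2 * a * c * (w^T *m u) 0 0 +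
  2 * b * c * (w^T *m v) 0 0.
Proof.
rewrite l2norm_sqr !mxE !big_distrr -!big_split /=.
by apply: eq_bigr => i _; rewrite !mxE; ring.
Qed.

End L2.

Lemma minimumE (R : realType) (A : set R) (x : R) :
  A x -> lbound A x -> minimum A = x.
Proof.
move=> Ax Alb; rewrite /minimum.
case: xgetP => [y _ [Ay lby]|/(_ x)]; last by case.
by apply/eqP; rewrite eq_le lby // Alb.
Qed.

Lemma sum_ord4 (V : nmodType) (F : 'I_4 -> V) :
  \sum_(i < 4) F i = F i1 + F i2 + F i3 + F i4.
Proof.
rewrite !big_ord_recr big_ord0 /= add0r.
by congr (F _ + F _ + F _ + F _); apply: val_inj.
Qed.

Definition col4 (R : realType) (a b c d : R) : 'cV[R]_4 :=
  \col_(i < 4) nth 0 [:: a; b; c; d] i.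

Lemma col4E (R : realType) (a b c d : R) :
  (col4 a b c d i1 0 = a) * (col4 a b c d i2 0 = b) *
  (col4 a b c d i3 0 = c) * (col4 a b c d i4 0 = d).
Proof. by rewrite !mxE. Qed.

Section Quadratic.
Variable R : realType.
Implicit Types (C theta a b c d : R).

(** The weights are the squared lengths of (X3 + X4) / 2, (X3 - X4) / 2 and V. *)
Definition quad C theta a b c d : R :=
  (C * (a + b) + c + d) ^+ 2 * ((1 - theta) / 2) +
  (c - d) ^+ 2 * ((1 + theta) / 2) +
  (a - b) ^+ 2 * (1 - C ^+ 2 * (1 - theta) / 2).

(** The bound on [C ^+ 2 * (1 - theta)] is twice as strong as the one assumed in the theorem; there
    it follows from varphi^2 = C^2 psi^2 and rho > 0. *)
Lemma quad_compat C theta a b c d :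
  1 < C -> 0 < 1 - theta -> C ^+ 2 * (1 - theta) < 1 -> 0 <= 1 + theta ->
  `|a| + `|b| = 1 -> `|c| + `|d| <= 1 ->
  (C - 1) ^+ 2 * (1 - theta) <= 2 * quad C theta a b c d.
Proof.
move=> C1 psi0 psi1 theta1 ab cd.
have sq1 : 0 <= (c - d) ^+ 2 * (1 + theta) by rewrite mulr_ge0 ?sqr_ge0.
have cd1 : `|c + d| <= 1 by exact: le_trans (ler_normD _ _) cd.
have [cd_lo cd_hi] : -1 <= c + d /\ c + d <= 1.
  by move: cd1; rewrite ler_norml => /andP[].
have sq0 : 0 <= (C * (a + b) + c + d) ^+ 2 * (1 - theta).
  by rewrite mulr_ge0 ?sqr_ge0 ?ltW.
have sq2 : 0 <= (a - b) ^+ 2 * (2 - C ^+ 2 * (1 - theta)).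
  by rewrite mulr_ge0 ?sqr_ge0 //; lra.
have sum1 : a + b = 1 \/ a + b = -1 ->
    (C - 1) ^+ 2 * (1 - theta) <= (C * (a + b) + c + d) ^+ 2 * (1 - theta).
  move=> ab1; rewrite ler_pM2r // -subr_ge0.
  have -> : (C * (a + b) + c + d) ^+ 2 - (C - 1) ^+ 2 =
    (C * (a + b) + (c + d) - (C - 1)) * (C * (a + b) + (c + d) + (C - 1)).
    by ring.
  (* Both factors have the sign of a + b, because |c + d| <= 1 < C. *)
  by case: ab1 => ->; [rewrite mulr_ge0|rewrite mulr_le0]; lra.
have diff1 : a - b = 1 \/ a - b = -1 ->
    (C - 1) ^+ 2 * (1 - theta) <= (a - b) ^+ 2 * (2 - C ^+ 2 * (1 - theta)).
  move=> ab1; have -> : (a - b) ^+ 2 = 1.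
    by case: ab1 => ->; rewrite ?sqrrN expr1n.
  (* With psi^2 = 1 - theta, the right side minus the left side is 2 (1 - C^2 psi^2) + (2 C - 1)
     psi^2. *)
  have : 0 <= (2 * C - 1) * (1 - theta) by rewrite mulr_ge0; lra.
  by nra.
have [/sum1|/diff1] : (a + b = 1 \/ a + b = -1) \/ (a - b = 1 \/ a - b = -1).
  by move: ab; case: (ger0P a); case: (ger0P b) => ? ?; lra.
all: by rewrite /quad; lra.
Qed.

(* The excess of the Lasso objective (with s = beta0_1, t = beta0_2) over its
   value at (s - k, t - k, 0, 0), where k = lambda / varphi^2. *)
Lemma lasso_excess C theta k s t a b c d :
  C != 0 ->
  let lambda := k * (C ^+ 2 * (1 - theta)) in
  quad C theta (a - s) (b - t) c d +
    2 * lambda * (`|a| + `|b| + `|c| + `|d|) =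
  quad C theta (- k) (- k) 0 0 + 2 * lambda * (s - k + (t - k)) +
  quad C theta (a - (s - k)) (b - (t - k)) c d +
  2 * lambda * ((`|a| - a) + (`|b| - b) +
                ((`|c| - c / C) + (`|d| - d / C))).
Proof. by move=> C0 lambda; rewrite /quad /lambda; field. Qed.

Lemma quad_ge0 C theta a b c d :
  0 <= 1 - theta -> 0 <= 1 + theta -> C ^+ 2 * (1 - theta) / 2 <= 1 ->
  0 <= quad C theta a b c d.
Proof.
move=> psi0 theta1 psi1.
rewrite /quad; apply: addr_ge0; first apply: addr_ge0;
  apply: mulr_ge0; rewrite ?sqr_ge0 ?subr_ge0 //; exact: divr_ge0.
Qed.

(** The squares of C (a + b) and a - b carry positive weights, so both vanish. *)
Lemma quad_eq0 C theta a b :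
  0 < C -> 0 < 1 - theta -> C ^+ 2 * (1 - theta) / 2 < 1 ->
  quad C theta a b 0 0 = 0 -> a = 0 /\ b = 0.
Proof.
move=> C0 psi0 psi1 /eqP.
rewrite /quad !addr0 subrr expr0n mul0r addr0 paddr_eq0; first last.
- by rewrite mulr_ge0 ?sqr_ge0 ?subr_ge0 ?ltW.
- by rewrite mulr_ge0 ?sqr_ge0 ?divr_ge0 ?ltW.
have v0 : 1 - C ^+ 2 * (1 - theta) / 2 != 0 by rewrite gt_eqF ?subr_gt0.
have p0 : (1 - theta) / 2 != 0 by rewrite gt_eqF ?divr_gt0.
move=> /andP[]; rewrite mulIr_eq0 ?sqrf_eq0; last exact/mulIf.
rewrite mulf_eq0 (gt_eqF C0) => /eqP ab.
rewrite mulIr_eq0 ?sqrf_eq0; last exact/mulIf.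
by move=> /eqP ba; split; lra.
Qed.

(** The certificate value 1 / C lies strictly inside [-1, 1]. The equality case is what forces a
    minimizer to vanish off S0. *)
Lemma norm_sub_div_ge0 C (c : R) : 1 < C -> 0 <= `|c| - c / C ?= iff (c == 0).
Proof.
move=> C1; have C0 : 0 < C by lra.
have [->|c0] := eqVneq c 0; first by rewrite normr0 mul0r subrr; apply/leifP.
apply/leifP; rewrite subr_gt0 (le_lt_trans (ler_norm _)) // normrM normfV.
by rewrite (gtr0_norm C0) ltr_pdivrMr // ltr_pMr ?normr_gt0.
Qed.

End Quadratic.

Theorem lemma14p2 (R : realType) (n : nat) (X : 'M[R]_(n, 4))
    (b0 : 'cV[R]_4) (V : 'cV[R]_n) (rho theta C : R) :
  let X1 := col i1 X in
  let X2 := col i2 X in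
  let X3 := col i3 X in
  let X4 := col i4 X in
  let S0 : {set 'I_4} := [set i1; i2]%SET in
  let varphi2 := 1 - rho in
  let psi2 := 1 - theta in
  fair_design X ->
  X1^T *m X2 = (- rho)%:M ->
  0 < rho -> rho < 1 ->
  active_set b0 = S0 ->
  b0 i2 0 <= b0 i1 0 -> 0 < b0 i2 0 ->
  (row_mx X3 X4)^T *m row_mx X3 X4 =
    block_mx 1%:M (- theta)%:M (- theta)%:M 1%:M ->
  X1 = (C / 2) *: (X3 + X4) + V ->
  X2 = (C / 2) *: (X3 + X4) - V ->
  V^T *m X3 = 0 -> V^T *m X4 = 0 ->
  1 < C ->
  C ^+ 2 * psi2 / 2 < 1 ->
  [/\ compatibility2 X S0 = (C - 1) ^+ 2 * psi2,
      effective_sparsity2 X S0 = 2 / ((C - 1) ^+ 2 * psi2),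
      varphi2 = C ^+ 2 * psi2 &
      forall lambda : R, 0 < lambda -> lambda / varphi2 <= b0 i2 0 ->
        (exists bstar : 'cV[R]_4, noiseless_lasso X b0 lambda bstar) /\
        (forall bstar : 'cV[R]_4, noiseless_lasso X b0 lambda bstar ->
          [/\ l2norm (X *m (bstar - b0)) ^+ 2 = 2 * lambda ^+ 2 / varphi2,
              2 * lambda ^+ 2 / varphi2 =
                lambda ^+ 2 * effective_sparsity2 X S0 *
                  ((C - 1) ^+ 2 / C ^+ 2) &
              l1norm (restr (~: S0)%SET bstar) = 0])].
Proof.
move=> X1 X2 X3 X4 S0 varphi2 psi2 [unitX _] X12 rho0 rho1 act b021 b02.
rewrite tr_row_mx mul_col_row => /eq_block_mx[G33 G34 _ G44].
move=> X1E X2E V3 V4 C1 Cpsi.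
have C0 : 0 < C by lra.
have g33 : (X3^T *m X3) 0 0 = 1 by rewrite G33 mxE.
have g34 : (X3^T *m X4) 0 0 = - theta by rewrite G34 mxE.
have g44 : (X4^T *m X4) 0 0 = 1 by rewrite G44 mxE.
have v3 : (V^T *m X3) 0 0 = 0 by rewrite V3 mxE.
have v4 : (V^T *m X4) 0 0 = 0 by rewrite V4 mxE.
have lin3 a b c : l2norm (a *: X3 + b *: X4 + c *: V) ^+ 2 =
    a ^+ 2 + b ^+ 2 + c ^+ 2 * (V^T *m V) 0 0 - 2 * a * b * theta.
  by rewrite dotmx_lin3 g33 g34 g44 v3 v4; ring.
have X1E' : X1 = (C / 2) *: X3 + (C / 2) *: X4 + 1 *: V.
  by rewrite X1E scalerDr scale1r.
have vv : (V^T *m V) 0 0 = 1 - C ^+ 2 * psi2 / 2.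
  have := unitX i1; rewrite -/X1 => X1u.
  by have := lin3 (C / 2) (C / 2) 1; rewrite -X1E' X1u /psi2; lra.
(* Here |X1 + X2|^2 is computed twice: from X1 + X2 = C (X3 + X4), and as 2 - 2 rho from the Gram
   entries of X1 and X2. *)
have varphi2E : varphi2 = C ^+ 2 * psi2.
  have : l2norm (X1 + X2) ^+ 2 = C ^+ 2 * (2 - 2 * theta).
    have -> : X1 + X2 = C *: X3 + C *: X4 + 0 *: V.
      by rewrite X1E X2E; apply/matrixP => i j; rewrite !mxE; field.
    by rewrite lin3; ring.
  have -> : X1 + X2 = 1 *: X1 + 1 *: X2 + 0 *: V.
    by rewrite !scale1r scale0r addr0.
  by rewrite dotmx_lin3 X12 -!l2norm_sqr !unitX !mxE /= /varphi2 /psi2; lra.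
have psi0 : 0 < psi2.
  by rewrite -(pmulr_rgt0 _ (exprn_gt0 2 C0)) -varphi2E subr_gt0.
(* This is half of |X3 - X4|^2. *)
have theta1 : 0 <= 1 + theta.
  have := sqr_ge0 (l2norm (1 *: X3 + -1 *: X4 + 0 *: V)).
  by rewrite lin3; lra.
have fitE b : l2norm (X *m b) ^+ 2 =
    quad C theta (b i1 0) (b i2 0) (b i3 0) (b i4 0).
  have -> : X *m b = (C / 2 * (b i1 0 + b i2 0) + b i3 0) *: X3 +
      (C / 2 * (b i1 0 + b i2 0) + b i4 0) *: X4 + (b i1 0 - b i2 0) *: V.
    apply/colP => i; rewrite !mxE sum_ord4.
    have /colP/(_ i) := X1E; have /colP/(_ i) := X2E; rewrite !mxE => -> ->.
    by field.
  by rewrite lin3 vv /psi2 /quad; field.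
have cardS0 : #|S0| = 2%N by rewrite cards2.
have l1S b : l1norm (restr S0 b) = `|b i1 0| + `|b i2 0|.
  by rewrite /l1norm sum_ord4 !mxE !inE /= !normr0 !addr0.
have l1SC b : l1norm (restr (~: S0)%SET b) = `|b i3 0| + `|b i4 0|.
  by rewrite /l1norm sum_ord4 !mxE !inE /= !normr0 !add0r.
have compE : compatibility2 X S0 = (C - 1) ^+ 2 * psi2.
  apply: minimumE.
    (* Equal entries within each pair kill the last two squares; a + b = 1 and c + d = -1 leave (C -
       1)^2 in the first. *)
    exists (col4 (1 / 2) (1 / 2) (- (1 / 2)) (- (1 / 2))) => /=.
      rewrite l1S l1SC !col4E !normrN ger0_norm; last by lra.
      by split; lra.
    by rewrite cardS0 fitE !col4E /quad /psi2; field.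
  move=> _ [b /= [b12 b34] <-]; rewrite cardS0 fitE.
  move: b12 b34; rewrite l1S l1SC => b12 b34; apply: quad_compat => //.
  by rewrite -varphi2E /varphi2; lra.
have effE : effective_sparsity2 X S0 = 2 / ((C - 1) ^+ 2 * psi2).
  by rewrite /effective_sparsity2 compE cardS0.
split=> // lambda lambda0 lambda_le.
have b03 : b0 i3 0 = 0.
  by have /setP/(_ i3) := act; rewrite !inE /= => /negbFE/eqP.
have b04 : b0 i4 0 = 0.
  by have /setP/(_ i4) := act; rewrite !inE /= => /negbFE/eqP.
(* Stationarity on S0 at beta0 - k (1, 1, 0, 0) reads k X1^T (X1 + X2) = lambda, and X1^T (X1 + X2)
   = 1 - rho. *)
set k := lambda / varphi2 in lambda_le *.
have lambdaE : lambda = k * (C ^+ 2 * (1 - theta)).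
  by rewrite /k -/psi2 -varphi2E divfK // gt_eqF ?subr_gt0.
set bs := col4 (b0 i1 0 - k) (b0 i2 0 - k) 0 0.
(* Besides the quadratic term, this is 2 lambda times the sum of |b_j| - z_j b_j for the certificate
   z = (1, 1, 1/C, 1/C). *)
pose gap (b : 'cV[R]_4) :=
  quad C theta (b i1 0 - (b0 i1 0 - k)) (b i2 0 - (b0 i2 0 - k))
    (b i3 0) (b i4 0) +
  2 * lambda * ((`|b i1 0| - b i1 0) + (`|b i2 0| - b i2 0) +
    ((`|b i3 0| - b i3 0 / C) + (`|b i4 0| - b i4 0 / C))).
have bsfit : l2norm (X *m (bs - b0)) ^+ 2 = quad C theta (- k) (- k) 0 0.
  rewrite fitE /bs; congr quad; rewrite mxE col4E mxE ?b03 ?b04; by ring.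
have objE b : lasso_objective X b0 lambda b =
    lasso_objective X b0 lambda bs + gap b.
  have bE : l2norm (X *m (b - b0)) ^+ 2 =
      quad C theta (b i1 0 - b0 i1 0) (b i2 0 - b0 i2 0) (b i3 0) (b i4 0).
    by rewrite fitE; congr quad; rewrite !mxE ?b03 ?b04 ?subr0.
  rewrite /lasso_objective bsfit bE /l1norm !sum_ord4 /bs !col4E !normr0 !addr0.
  (* Since k <= beta0_2 <= beta0_1, the active entries of [bs] are nonnegative. *)
  rewrite (@ger0_norm _ (_ - k)) ?(@ger0_norm _ (b0 i2 0 - k)); try lra.
  rewrite /gap addrA lambdaE; apply: lasso_excess; exact: lt0r_neq0.
have quad0 := @quad_ge0 R C theta _ _ _ _ (ltW psi0) theta1 (ltW Cpsi).
have norm0 (x : R) : 0 <= `|x| - x by rewrite subr_ge0 ler_norm.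
have off0 (x : R) : 0 <= `|x| - x / C := (norm_sub_div_ge0 x C1).1.
have off_eq0 (x : R) : `|x| - x / C = 0 -> x = 0.
  by move/esym/eqP; rewrite (norm_sub_div_ge0 x C1).2 => /eqP.
have pen0 (b : 'cV[R]_4) : 0 <= 2 * lambda *
    ((`|b i1 0| - b i1 0) + (`|b i2 0| - b i2 0) +
     ((`|b i3 0| - b i3 0 / C) + (`|b i4 0| - b i4 0 / C))).
  apply: mulr_ge0; first by rewrite mulr_ge0 ?ltW.
  by apply: addr_ge0; apply: addr_ge0.
have gap0 b : 0 <= gap b by apply: addr_ge0.
split; first by exists bs => b /=; rewrite (objE b) lerDl.
move=> b /(_ bs); rewrite /= (objE b) gerDl => gap_le.
have /eqP : gap b = 0 by apply/eqP; rewrite eq_le gap_le gap0.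
rewrite paddr_eq0 ?quad0 ?pen0 // => /andP[/eqP q0].
rewrite mulf_eq0 gt_eqF ?mulr_gt0 //= paddr_eq0; try exact: addr_ge0.
(* A zero gap makes every nonnegative summand zero. The entries off S0 vanish first, which brings
   the quadratic term to the form treated by [quad_eq0]. *)
case/andP => _; rewrite paddr_eq0 ?off0 // => /andP[].
move=> /eqP/off_eq0 b3 /eqP/off_eq0 b4.
move: q0; rewrite b3 b4 => /(quad_eq0 C0 psi0 Cpsi)[b1 b2].
have {gap_le} bE : b = bs.
  apply/colP => i; rewrite /bs mxE.
  have : i \in [:: i1; i2; i3; i4] by case: i => -[|[|[|[|]]]].
  by rewrite !inE => /or4P[]/eqP-> /=; lra.
have nzC1 : C - 1 != 0 by rewrite gt_eqF ?subr_gt0.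
have nzC := lt0r_neq0 C0; have nzpsi := lt0r_neq0 psi0.
split; last by rewrite l1SC b3 b4 normr0 addr0.
- rewrite bE bsfit varphi2E lambdaE /quad /psi2.
  by field; apply/andP.
- by rewrite effE varphi2E; field; rewrite nzC1 nzC nzpsi.
Qed.
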